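(* Let $\Delta$ be a finite simplicial complex and let $d\ge 0$ be an integer. If $\Delta$ has a vertex whose degree in the $1$-skeleton $\Delta^{(1)}$ equals $d$, then the Morse complex $\mathcal{M}(\Delta)$ is $(d-2)$-connected.
   Context: $\Delta$ is a finite abstract simplicial complex; simplices are non-empty, and $\sigma^{(p)}$ indicates that the simplex $\sigma$ has dimension $p$. A primitive discrete vector field on $\Delta$ is a pair $(\sigma^{(p)},\tau^{(p+1)})$ of simplices with $\sigma$ a codimension-$1$ face of $\tau$. A discrete vector field $V$ on $\Delta$ is a collection of primitive discrete vector fields such that each simplex of $\Delta$ occurs in at most one pair of $V$. A $V$-path is a sequence of simplices $\sigma_0^{(p)},\tau_0^{(p+1)},\sigma_1^{(p)},\tau_1^{(p+1)},\dots,\tau_{m-1}^{(p+1)},\sigma_m^{(p)}$ such that for each $0\le i\le m-1$ we have $(\sigma_i,\tau_i)\in V$ and $\tau_i>\sigma_{i+1}\ne\sigma_i$. A $V$-cycle is a $V$-path with $m>0$ and $\sigma_m=\sigma_0$. $V$ is acyclic if there are no $V$-cycles. The Morse complex $\mathcal{M}(\Delta)$ is the simplicial complex whose simplices are the non-empty acyclic discrete vector fields on $\Delta$, with face relation given by inclusion (so its vertices are the primitive discrete vector fields). A space is $n$-connected if it is non-empty and its homotopy groups $\pi_k$ vanish for all $0\le k\le n$; $(-1)$-connected means non-empty, and being $n$-connected for $n\le -2$ is a vacuous condition. Topological statements about simplicial complexes refer to geometric realizations. *)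

(* Defs.v *)
(* MathComp / MathComp-Analysis *)
From HB Require Import structures.
From mathcomp Require Import all_boot all_order all_algebra.
From mathcomp Require Import all_classical all_reals all_analysis.

Set Implicit Arguments.
Unset Strict Implicit.
Unset Printing Implicit Defensive.

Import Order.TTheory GRing.Theory Num.Theory.
Import numFieldNormedType.Exports.

Local Open Scope ring_scope.

Section SimplicialComplexes.
Variable T : finType.
Implicit Types s t : {set T}.

(* The vertices of a complex are the v with [set v] a simplex; the type T may
   contain elements that are not vertices. *)
Record simplicial_complex := SimplicialComplex {
  simplices :> {set {set T}};
  simplex_nonempty : forall s, s \in simplices -> s != finset.set0;
  simplex_face : forall s t,
    t \in simplices -> s \subset t -> s != finset.set0 -> s \in simplices }.

(* Only meaningful for non-empty s. *)
Definition sdim s : nat := #|s|.-1.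

Definition skeleton_simplices (k : nat) (K : simplicial_complex) :=
  [set s in simplices K | (sdim s <= k)%N]%SET.

Lemma skeleton_nonempty k K s :
  s \in skeleton_simplices k K -> s != finset.set0.
Proof. by rewrite inE => /andP[/simplex_nonempty]. Qed.

Lemma skeleton_face k K s t : t \in skeleton_simplices k K ->
  s \subset t -> s != finset.set0 -> s \in skeleton_simplices k K.
Proof.
rewrite !inE => /andP[tK tk] st s0; rewrite (simplex_face tK st s0) /=.
apply: leq_trans tk; rewrite /sdim -!subn1 leq_sub2r //; exact: subset_leq_card.
Qed.

Definition skeleton k K : simplicial_complex :=
  SimplicialComplex (@skeleton_nonempty k K) (@skeleton_face k K).

Definition degree (K : simplicial_complex) (v : T) : nat :=
  #|[set e in simplices K | (sdim e == 1%N) && (v \in e)]%SET|.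

End SimplicialComplexes.

Section Morse.
Variables (T : finType) (K : simplicial_complex T).
Implicit Types (s : {set T}) (q : {set T} * {set T}).
Implicit Types V W : {set {set T} * {set T}}.

Definition primitive_dvf q : Prop :=
  [/\ q.1 \in simplices K, q.2 \in simplices K, q.1 \subset q.2
    & sdim q.2 = (sdim q.1).+1].

Definition occurs_in s q : Prop := s = q.1 \/ s = q.2.

Definition discrete_vector_field V : Prop :=
  (forall q, q \in V -> primitive_dvf q) /\
  (forall s q q', s \in simplices K -> q \in V -> q' \in V ->
     occurs_in s q -> occurs_in s q' -> q = q').

(* Only sigma 0, ..., sigma m and tau 0, ..., tau (m - 1) matter. *)
Definition V_path V (p m : nat) (sigma tau : nat -> {set T}) : Prop :=
  [/\ forall i, (i <= m)%N -> sigma i \in simplices K /\ sdim (sigma i) = p,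
      forall i, (i < m)%N -> tau i \in simplices K /\ sdim (tau i) = p.+1
    & forall i, (i < m)%N ->
        [/\ (sigma i, tau i) \in V, sigma i.+1 \proper tau i
          & sigma i.+1 <> sigma i]].

Definition V_cycle V p m sigma tau : Prop :=
  [/\ V_path V p m sigma tau, (0 < m)%N & sigma m = sigma 0%N].

Definition acyclic V : Prop :=
  ~ exists p m sigma tau, V_cycle V p m sigma tau.

Definition morse_simplices : {set {set {set T} * {set T}}} :=
  [set V | (V != finset.set0) && `[< discrete_vector_field V /\ acyclic V >]]%SET.

Lemma morse_nonempty V : V \in morse_simplices -> V != finset.set0.
Proof. by rewrite inE => /andP[]. Qed.

Lemma morse_face W V : V \in morse_simplices ->
  W \subset V -> W != finset.set0 -> W \in morse_simplices.
Proof.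
rewrite !inE => /andP[_ /asboolP[[prV unV] acV]] /fintype.subsetP WV -> /=.
apply/asboolP; split; first split.
- by move=> q /WV; exact: prV.
- by move=> s q q' sK /WV qV /WV q'V; exact: unV sK qV q'V.
- move=> [p [m [sigma [tau [[H1 H2 H3] m0 e]]]]]; apply: acV.
  exists p, m, sigma, tau; split=> //; split=> // i /H3[/WV] *.
  by split.
Qed.

Definition morse_complex : simplicial_complex ({set T} * {set T})%type :=
  SimplicialComplex morse_nonempty morse_face.

End Morse.

Local Open Scope classical_set_scope.

Section Realization.
Variables (R : realType) (T : finType) (K : simplicial_complex T).

(* Barycentric coordinates.  As T is finite, the product topology on R^T is
   the Euclidean one. *)
Definition realization_set : set (prod_topology (fun _ : T => R)) :=
  [set x | [/\ forall v, 0 <= x v, \sum_v x v = 1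
             & [set v | x v != 0]%SET \in simplices K]].

Definition realization : topologicalType := set_type realization_set.

End Realization.

Section HomotopyGroups.
Variables (R : realType) (X : topologicalType).

Definition cube (k : nat) : set 'rV[R]_k := [set u | forall i, 0 <= u 0 i <= 1].

Definition cube_boundary (k : nat) : set 'rV[R]_k :=
  [set u | cube u /\ exists i, u 0 i = 0 \/ u 0 i = 1].

(* Maps (I^k, boundary of I^k) -> (X, x0); values outside the cube are
   irrelevant.  For k = 0 the cube is a point with empty boundary. *)
Definition sphere_map (k : nat) (x0 : X) : set ('rV[R]_k -> X) :=
  [set f | {within @cube k, continuous f} /\
           forall u, cube_boundary u -> f u = x0].

Definition homotopic (k : nat) (x0 : X) (f g : 'rV[R]_k -> X) : Prop :=
  exists H : R * 'rV[R]_k -> X,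
    [/\ {within `[0, 1] `*` @cube k, continuous H},
        forall u, cube u -> H (0, u) = f u,
        forall u, cube u -> H (1, u) = g u
      & forall (t : R) u, 0 <= t <= 1 -> cube_boundary u -> H (t, u) = x0].

Definition homotopy_class (k : nat) (x0 : X) (f : 'rV[R]_k -> X) :
    set ('rV[R]_k -> X) :=
  [set g | sphere_map x0 g /\ homotopic x0 f g].

(* The underlying set of pi_k(X, x0), with neutral element the class of the
   constant map. *)
Definition homotopy_group (k : nat) (x0 : X) : set (set ('rV[R]_k -> X)) :=
  [set homotopy_class x0 f | f in @sphere_map k x0].

Definition homotopy_group_vanishes (k : nat) (x0 : X) : Prop :=
  @homotopy_group k x0 = [set homotopy_class x0 (cst x0)].

Definition n_connected (n : int) : Prop :=
  (-1 <= n -> [set: X] !=set0) /\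
  (forall k : nat, k%:Z <= n -> forall x0 : X, homotopy_group_vanishes k x0).

End HomotopyGroups.

(* Main.v *)
(* Let [A] be the set of spokes [({w}, {v, w})], for [w] a neighbor of [v].
   Every gradient field [V] can be enlarged by all the spokes that do not clash
   with [V] and whose [w] is not reached from [v] along the arrows of [V]; this
   set [G V] of free spokes decreases as [V] grows, and it misses at most [#|V|]
   of the [d] spokes, so that it is nonempty when [#|V| < d].  A map from a
   [k]-cube, [k <= d - 2], can be pushed into the [k]-skeleton (Freudenthal
   triangulation, simplicial approximation).  A point of that skeleton is moved
   into the simplex [A] by cutting its barycentric coordinates off at a height
   [t] growing from 0 to 1, while a spoke receives weight as soon as it is free
   with respect to the set of coordinates above [t].  The simplex [A] is then
   contracted, and a collar of the cube turns this free homotopy into one that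
   is fixed on the boundary. *)
Require Import Defs.
From mathcomp Require Import all_boot all_order all_algebra.
From mathcomp Require Import all_classical all_reals all_analysis.
From mathcomp Require Import zify lra.

Set Implicit Arguments.
Unset Strict Implicit.
Unset Printing Implicit Defensive.

Import Order.TTheory GRing.Theory Num.Theory numFieldNormedType.Exports.

Local Open Scope classical_set_scope.
Local Open Scope ring_scope.

(** * Clamping and continuity *)

Section Clamp.
Variable R : realType.
Implicit Types (t : R) (k : nat).

Definition clamp t : R := Num.max 0 (Num.min t 1).

Lemma clamp_itv t : 0 <= clamp t <= 1.
Proof. by rewrite /clamp le_max lexx ge_max ler01 ge_min lexx orbT. Qed.

Lemma clamp_id t : 0 <= t <= 1 -> clamp t = t.
Proof. by case/andP=> t0 t1; rewrite /clamp min_l // max_r. Qed.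

Lemma clamp_le0 t : t <= 0 -> clamp t = 0.
Proof. by move=> t0; rewrite /clamp max_l // ge_min t0. Qed.

Lemma clamp_ge1 t : 1 <= t -> clamp t = 1.
Proof. by move=> t1; rewrite /clamp min_r // max_r. Qed.

(** A retraction of the whole space onto the cube; precomposing with it turns maps continuous only
    within the cube into globally continuous ones. *)
Definition clamp_row k (u : 'rV[R]_k) : 'rV[R]_k := \row_i clamp (u 0 i).

Lemma clamp_row_cube k u : cube (@clamp_row k u).
Proof. by move=> i; rewrite mxE clamp_itv. Qed.

Lemma clamp_row_id k (u : 'rV[R]_k) : cube u -> clamp_row u = u.
Proof. by move=> cu; apply/rowP => i; rewrite mxE clamp_id. Qed.

End Clamp.

(* A folded form of [continuous]: its domain and codomain stay bundled as
   [topologicalType]s, so that unification does not have to compare the several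
   paths by which [R] and its products inherit their topology. *)
Definition cont (U V : topologicalType) (f : U -> V) : Prop := continuous f.

Lemma cont_comp (U V W : topologicalType) (f : U -> V) (g : V -> W) :
  cont f -> cont g -> cont (fun y => g (f y)).
Proof. by move=> cf cg y; apply: (@continuous_comp _ _ _ f g); [exact: cf|exact: cg]. Qed.

Lemma cont_cst (U V : topologicalType) (a : V) : cont (fun _ : U => a).
Proof. by move=> y; exact: cvg_cst. Qed.

Lemma cont_fst (U V : topologicalType) : cont (@fst U V).
Proof. by move=> y; exact: cvg_fst. Qed.

Lemma cont_snd (U V : topologicalType) : cont (@snd U V).
Proof. by move=> y; exact: cvg_snd. Qed.

Lemma cont_pair (Y U V : topologicalType) (f : Y -> U) (g : Y -> V) :
  cont f -> cont g -> cont (fun y => (f y, g y)).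
Proof.
move=> cf cg y; rewrite /continuous_at.
by apply: (@cvg_pair _ _ _ (nbhs y) (nbhs (f y)) (nbhs (g y)) _ _ _ f g);
  [exact: cf|exact: cg].
Qed.

Lemma cont_within_comp (U V W : topologicalType) (D : set V)
    (h : V -> W) (c : U -> V) :
  {within D, continuous h} -> cont c -> (forall y, D (c y)) ->
  cont (fun y => h (c y)).
Proof.
move=> /subspace_continuousP ch cc Dc y A /(ch _ (Dc y)) hA.
have := cc y _ hA; rewrite !nbhs_simpl /=.
by apply: filterS => z /= /(_ (Dc z)).
Qed.

Section RealContinuity.
Variables (R : realType) (Y : topologicalType).
Implicit Types f g : Y -> R.

Lemma cont_max f g : cont f -> cont g -> cont (fun y => Num.max (f y) (g y)).
Proof. by move=> cf cg y; apply: continuous_max; [exact: cf|exact: cg]. Qed.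

Lemma cont_min f g : cont f -> cont g -> cont (fun y => Num.min (f y) (g y)).
Proof. by move=> cf cg y; apply: continuous_min; [exact: cf|exact: cg]. Qed.

Lemma cont_add f g : cont f -> cont g -> cont (fun y => f y + g y).
Proof. by move=> cf cg y; apply: cvgD; [exact: cf|exact: cg]. Qed.

Lemma cont_sub f g : cont f -> cont g -> cont (fun y => f y - g y).
Proof. by move=> cf cg y; apply: cvgB; [exact: cf|exact: cg]. Qed.

Lemma cont_mul f g : cont f -> cont g -> cont (fun y => f y * g y).
Proof. by move=> cf cg y; apply: cvgM; [exact: cf|exact: cg]. Qed.

Lemma cont_inv f : (forall y, f y != 0) -> cont f -> cont (fun y => (f y)^-1).
Proof. by move=> f0 cf y; apply: cvgV => //; exact: cf. Qed.

Lemma cont_clamp f : cont f -> cont (fun y => clamp (f y)).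
Proof.
by move=> cf; apply: cont_max; [exact: cont_cst|apply: cont_min => //; exact: cont_cst].
Qed.

(** The operation is left arbitrary so that sums, maxima and minima are covered at once. *)
Lemma cont_big (op : R -> R -> R) (z : R) (I : Type) (r : seq I) (P : pred I)
    (F : Y -> I -> R) :
  (forall f g, cont f -> cont g -> cont (fun y => op (f y) (g y))) ->
  (forall i, P i -> cont (F^~ i)) ->
  cont (fun y => \big[op/z]_(i <- r | P i) F y i).
Proof.
move=> cop cF; elim: r => [|i r IH].
  by under eq_fun do rewrite big_nil; exact: cont_cst.
have [Pi|/negbTE Pi] := boolP (P i).
  rewrite (_ : (fun y => _) =
    (fun y => op (F y i) (\big[op/z]_(i <- r | P i) F y i))).
    by apply: cop => //; exact: cF.
  by apply/funext => y; rewrite big_cons Pi.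
rewrite (_ : (fun y => _) = (fun y => \big[op/z]_(i <- r | P i) F y i)) //.
by apply/funext => y; rewrite big_cons Pi.
Qed.

Lemma cont_coord k (F : Y -> 'rV[R]_k) i : cont F -> cont (fun y => F y 0 i).
Proof.
move=> cF; apply: (@cont_comp _ _ _ F (fun v : 'rV[R]_k => v 0 i)) => //.
exact: coord_continuous.
Qed.

Lemma cont_row k (F : Y -> 'I_k -> R) :
  (forall i, cont (F^~ i)) -> cont (fun y => \row_i F y i).
Proof.
move=> cF y A [P yP PA]; rewrite nbhs_simpl /=.
have : \forall z \near y, forall i, P 0 i (F z i).
  by apply: filter_forall => i; apply: cF; have := yP 0 i; rewrite mxE.
by apply: filterS => z Pz; apply: PA => i j; rewrite ord1 mxE.
Qed.

Lemma cont_clamp_row k (F : Y -> 'rV[R]_k) :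
  cont F -> cont (fun y => clamp_row (F y)).
Proof.
by move=> cF; apply: cont_row => i; apply: cont_clamp; exact: cont_coord.
Qed.

End RealContinuity.

(** * Homotopies of cube maps *)

Section Homotopic.
Variables (R : realType) (X : topologicalType) (k : nat) (x0 : X).
Implicit Types f g : 'rV[R]_k -> X.

Lemma homotopic_cont f g : homotopic x0 f g ->
  exists H : R * 'rV[R]_k -> X,
    [/\ cont H, forall u, cube u -> H (0, u) = f u,
        forall u, cube u -> H (1, u) = g u
      & forall (t : R) u, 0 <= t <= 1 -> cube_boundary u -> H (t, u) = x0].
Proof.
move=> [H [cH H0 H1 Hb]].
exists (fun y : R * 'rV[R]_k => H (clamp y.1, clamp_row y.2)); split.
- apply: (cont_within_comp cH).
    apply: cont_pair; first exact/cont_clamp/cont_fst.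
    exact/cont_clamp_row/cont_snd.
  by move=> y; split; [rewrite /= in_itv /= clamp_itv|exact: clamp_row_cube].
- by move=> u cu; rewrite /= clamp_le0 // clamp_row_id // H0.
- by move=> u cu; rewrite /= clamp_ge1 // clamp_row_id // H1.
- by move=> t u t01 [cu bu]; rewrite /= clamp_id // clamp_row_id // Hb.
Qed.

Lemma cont_homotopic f g (H : R * 'rV[R]_k -> X) : cont H ->
  (forall u, cube u -> H (0, u) = f u) ->
  (forall u, cube u -> H (1, u) = g u) ->
  (forall (t : R) u, 0 <= t <= 1 -> cube_boundary u -> H (t, u) = x0) ->
  homotopic x0 f g.
Proof. by move=> cH *; exists H; split => //; exact: continuous_subspaceT. Qed.

Lemma homotopic_sym f g : homotopic x0 f g -> homotopic x0 g f.
Proof.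
move=> /homotopic_cont[H [cH H0 H1 Hb]].
apply: (@cont_homotopic _ _ (fun y => H (1 - y.1, y.2))).
- apply: (@cont_comp _ _ _ (fun y : R * 'rV[R]_k => (1 - y.1 : R, y.2)) H) => //.
  apply: cont_pair; last exact: cont_snd.
  by apply: cont_sub; [exact: cont_cst|exact: cont_fst].
- by move=> u cu; rewrite subr0 H1.
- by move=> u cu; rewrite subrr H0.
- by move=> t u t01 bu; apply: Hb => //=; lra.
Qed.

End Homotopic.

(** * Barycentric coordinates *)

Section Barycentric.
Variables (R : realType) (S : finType) (K : simplicial_complex S).
Local Notation X := (realization R K).
Implicit Types (x : X) (q : S).

Definition bary x q : R := set_val x q.

Lemma bary_ge0 x q : 0 <= bary x q.
Proof. by have [+ _ _] := set_valP x; apply. Qed.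

Lemma bary_sum x : \sum_q bary x q = 1.
Proof. by have [_ + _] := set_valP x. Qed.

Definition supp x : {set S} := [set q | bary x q != 0]%SET.

Lemma supp_simplex x : supp x \in simplices K.
Proof. by have [] := set_valP x. Qed.

Lemma in_supp x q : (q \in supp x) = (0 < bary x q).
Proof. by rewrite inE lt_neqAle bary_ge0 andbT eq_sym. Qed.

Lemma bary_le1 x q : bary x q <= 1.
Proof.
rewrite -(bary_sum x) (bigD1 q) //= lerDl.
by apply: sumr_ge0 => i _; exact: bary_ge0.
Qed.

Lemma bary_inj x x' : bary x =1 bary x' -> x = x'.
Proof. by move=> e; apply: val_inj; apply/funext => q; exact: e. Qed.

Lemma cont_bary (Y : topologicalType) (h : Y -> X) q :
  cont h -> cont (fun z => bary (h z) q).
Proof.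
move=> ch; apply: (@cont_comp _ (prod_topology (fun _ : S => R)) R
  (fun z => set_val (h z)) (fun w => w q)).
  by apply: (@cont_comp _ _ _ h set_val) => //; exact: initial_continuous.
exact: (@proj_continuous S (fun _ => R) q).
Qed.

(** The realization carries the initial topology of its coordinates, so continuity can be tested on
    each of them. *)
Lemma cont_realization (Y : topologicalType) (h : Y -> X) :
  (forall q, cont (fun y => bary (h y) q)) -> cont h.
Proof.
move=> ch; apply: continuous_comp_initial => z.
apply/cvg_sup => q A [_ [[W oW <-]]] /= Wz /filterS; apply.
by apply: (ch q z W); exact: open_nbhs_nbhs.
Qed.

(** Dividing by the total weight reduces the construction of maps and homotopies to a choice of
    nonnegative weights, whose formulas can then ignore that coordinates sum to 1. *)
Lemma realize (Y : topologicalType) (w : Y -> S -> R) :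
  (forall q, cont (w^~ q)) -> (forall y q, 0 <= w y q) ->
  (forall y, exists2 V, V \in simplices K & forall q, 0 < w y q -> q \in V) ->
  (forall y, exists q, 0 < w y q) ->
  exists2 h : Y -> X, cont h & forall y q, bary (h y) q = w y q / \sum_p w y p.
Proof.
move=> cw w0 wK wn0.
have s0 y : 0 < \sum_p w y p.
  have [q qw] := wn0 y; rewrite (bigD1 q) //= ltr_pwDl //.
  by apply: sumr_ge0 => *; exact: w0.
have wX y : realization_set K (fun q => w y q / \sum_p w y p).
  split => [q||]; first by rewrite divr_ge0 // ltW.
    by rewrite -mulr_suml divff // gt_eqF.
  have [V VK wV] := wK y; apply: (simplex_face VK).
    apply/fintype.subsetP => q; rewrite inE mulf_eq0 invr_eq0 negb_or => /andP[wq _].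
    by apply: wV; rewrite lt_neqAle eq_sym wq w0.
  apply/finset.set0Pn; have [q qw] := wn0 y; exists q.
  by rewrite inE gt_eqF // divr_gt0.
pose h y : X := @exist _ (fun w => w \in realization_set K) _ (mem_set (wX y)).
exists h => //.
apply: cont_realization => q; apply: cont_mul => //.
apply: cont_inv; first by move=> y; rewrite gt_eqF.
by apply: cont_big => // f g; exact: cont_add.
Qed.

Lemma homotopic_trans k (x0 : X) (f g h : 'rV[R]_k -> X) :
  homotopic x0 f g -> homotopic x0 g h -> homotopic x0 f h.
Proof.
move=> /homotopic_cont[F [cF F0 F1 Fb]] /homotopic_cont[G [cG G0 G1 Gb]].
pose E (y : R * 'rV[R]_k) := if 2 * y.1 <= 1
  then F (clamp (2 * y.1), clamp_row y.2)
  else G (clamp (2 * y.1 - 1), clamp_row y.2).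
have FG u : cube u -> F (1, u) = G (0, u) by move=> cu; rewrite F1 // G0.
apply: (@cont_homotopic _ _ _ _ _ _ E).
- (* Where both pieces are active one of them is frozen at the common value,
     so each coordinate of [E] is a sum of continuous functions. *)
  apply: cont_realization => q.
  rewrite (_ : (fun y => _) = (fun y : R * 'rV[R]_k =>
    bary (F (clamp (2 * y.1), clamp_row y.2)) q
    + bary (G (clamp (2 * y.1 - 1), clamp_row y.2)) q
    - bary (G (0, clamp_row y.2)) q)); last first.
    apply/funext => y; rewrite /E; case: lerP => y1.
      rewrite [clamp (_ - 1)]clamp_le0 ?subr_le0 //.
      by rewrite addrK.
    rewrite [clamp (2 * y.1)]clamp_ge1 ?(ltW y1) // FG; last exact: clamp_row_cube.
    by rewrite addrAC subrr add0r.
  have cq (Z : R * 'rV[R]_k -> X) (a : R * 'rV[R]_k -> R) :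
      cont Z -> cont a -> cont (fun y => bary (Z (a y, clamp_row y.2)) q).
    move=> cZ ca; apply: cont_bary.
    apply: (@cont_comp _ _ _ (fun y => (a y, clamp_row y.2)) Z) => //.
    by apply: cont_pair => //; exact/cont_clamp_row/cont_snd.
  have c2 : cont (fun y : R * 'rV[R]_k => 2 * y.1 : R).
    by apply: cont_mul; [exact: cont_cst|exact: cont_fst].
  apply: cont_sub; last by apply: cq => //; exact: cont_cst.
  apply: cont_add; apply: cq => //; apply: cont_clamp => //.
  by apply: cont_sub => //; exact: cont_cst.
- move=> u cu; rewrite /E /= mulr0 ler01 clamp_le0 // clamp_row_id // F0 //.
- move=> u cu; rewrite /E /= mulr1 clamp_row_id //.
  rewrite leNgt ltr1n /= [clamp _]clamp_ge1 ?G1 //; lra.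
- move=> t u t01 bu; rewrite /E /= clamp_row_id; last by case: bu.
  by case: ifP => _; [apply: Fb|apply: Gb] => //; exact: clamp_itv.
Qed.

End Barycentric.

(** * Simplicial approximation *)

Section Hats.
Variables (R : realType) (k N : nat).
Implicit Types (z : {ffun 'I_k -> 'I_N.+1}) (u : 'rV[R]_k).

(* The hat functions of the Freudenthal triangulation of the grid of mesh
   [1 / N]: the simplex carrying [u] consists of the grid points [z / N] with
   [0 < hat z u]. *)
Definition hat z u : R :=
  Num.max 0 (1 - \big[Num.max/0]_i (N%:R * u 0 i - (z i)%:R)
               - \big[Num.max/0]_i ((z i)%:R - N%:R * u 0 i)).

Lemma hat_ge0 z u : 0 <= hat z u.
Proof. by rewrite /hat le_max lexx. Qed.

(** With [a] and [b] the two maxima of [hat], positivity means [a + b < 1]; the bounds estimate each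
    maximum from below by one of its terms or by 0. *)
Lemma hat_gt0 z u : 0 < hat z u ->
  [/\ forall i, N%:R * u 0 i - (z i)%:R < 1,
      forall i, (z i)%:R - N%:R * u 0 i < 1
    & forall i j, (N%:R * u 0 i - (z i)%:R) + ((z j)%:R - N%:R * u 0 j) < 1].
Proof.
rewrite /hat lt_max ltxx /=.
set a := \big[_/_]_i _; set b := \big[_/_]_i _ => ab.
have a0 : 0 <= a by exact: bigmax_ge_id.
have b0 : 0 <= b by exact: bigmax_ge_id.
have ai i : N%:R * u 0 i - (z i)%:R <= a by exact: le_bigmax.
have bi i : (z i)%:R - N%:R * u 0 i <= b by exact: le_bigmax.
split=> [i|i|i j].
- by apply: (le_lt_trans (ai i)); lra.
- by apply: (le_lt_trans (bi i)); lra.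
- by apply: (le_lt_trans (lerD (ai i) (bi j))); lra.
Qed.

Lemma hat_near z u i : (0 < N)%N -> 0 < hat z u ->
  `|u 0 i - (z i)%:R / N%:R| < N%:R^-1.
Proof.
move=> N0 /hat_gt0[/(_ i) zi1 /(_ i) zi2 _].
have N0' : (0 : R) < N%:R by rewrite ltr0n.
have -> : u 0 i - (z i)%:R / N%:R = (N%:R * u 0 i - (z i)%:R) / N%:R.
  by rewrite mulrBl mulrAC divff ?mul1r // gt_eqF.
rewrite normrM normfV (gtr0_norm N0') -[ltRHS]mul1r ltr_pM2r ?invr_gt0 //.
by rewrite ltr_norml; lra.
Qed.

Lemma hat_le1 z z' u i : 0 < hat z u -> 0 < hat z' u -> (z' i <= (z i).+1)%N.
Proof.
move=> /hat_gt0[/(_ i) h _ _] /hat_gt0[_ /(_ i) h' _].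
by rewrite -ltnS -(ltr_nat R) -[(z i).+2]addn2 natrD; lra.
Qed.

(** If [z i < z' i] and [z' j < z j], the mixed bounds of [hat_gt0] add up, the terms in [u]
    cancelling, to [(z' i - z i) + (z j - z' j) < 2], which is impossible for two positive
    integers. *)
Lemma hat_chain z z' u : 0 < hat z u -> 0 < hat z' u ->
  (forall i, (z i <= z' i)%N) \/ (forall i, (z' i <= z i)%N).
Proof.
move=> /hat_gt0[_ _ h] /hat_gt0[_ _ h'].
have [/forallP|] := boolP [forall i, (z i <= z' i)%N]; first by left.
rewrite negb_forall => /existsP[j]; rewrite -ltnNge => zj; right=> i.
rewrite leqNgt; apply/negP => zi.
move: zi zj; rewrite -!(ler_nat R) -![_.+1%:R]natr1.
by have := h i j; have := h' j i; lra.
Qed.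

(* Along a chain the coordinate sum is injective, and it varies by at most [k]
   since each coordinate varies by at most 1. *)
Lemma card_hat u : (#|[set z | (0 < hat z u)%R]%SET| <= k.+1)%N.
Proof.
set P := [set z | 0 < hat z u]%SET.
have [->|/finset.set0Pn[z1 z1P]] := eqVneq P finset.set0; first by rewrite cards0.
pose s z := (\sum_i z i)%N.
(* Since the set is a chain, a point of least coordinate sum lies below all others. *)
have [z0 z0P z0min] := @arg_minnP _ z1 (mem P) s z1P.
have hP z : z \in P -> 0 < hat z u by rewrite inE.
have le_s z z' : (forall i, (z i <= z' i)%N) -> (s z' <= s z)%N -> z = z'.
  move=> zz' ss'; apply/ffunP => i; apply/val_inj/eqP => /=.
  rewrite eqn_leq zz' /= leqNgt; apply/negP => lti.
  move: ss'; rewrite leqNgt => /negP; apply.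
  rewrite /s (bigD1 i) //= [ltnRHS](bigD1 i) //= -addSn leq_add //.
  by apply: leq_sum => j _; exact: zz'.
have z0le z : z \in P -> forall i, (z0 i <= z i)%N.
  move=> zP; have [//|zz0] := hat_chain (hP _ z0P) (hP _ zP).
  by rewrite (le_s z z0 zz0 (z0min _ zP)).
have s_le z : z \in P -> (s z <= s z0 + k)%N.
  move=> zP; have -> : k = (\sum_(i < k) 1)%N by rewrite sum1_card card_ord.
  rewrite -big_split /=; apply: leq_sum => i _; rewrite addn1.
  by apply: (hat_le1 i (hP _ z0P)); exact: hP.
pose t z : 'I_k.+1 := inord (s z - s z0).
have t_inj : {in P &, injective t}.
  move=> z z' zP z'P /(congr1 val); rewrite /= !inordK ?ltnS ?leq_subLR ?s_le //.
  move=> ss'; have {}ss' : s z = s z'.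
    by rewrite -(subnK (z0min _ zP)) ss' subnK // z0min.
  have [zz'|zz'] := hat_chain (hP _ zP) (hP _ z'P).
    by apply: le_s => //; rewrite ss'.
  by apply/esym/le_s => //; rewrite ss'.
by rewrite -(card_in_imset t_inj) (leq_trans (max_card _)) // card_ord.
Qed.

(** Rounding [N u] down works: the second maximum of [hat] vanishes and the first consists of
    fractional parts, hence is below 1. *)
Lemma hat_exists u : cube u -> exists z, 0 < hat z u.
Proof.
move=> cu; pose m i := Num.truncn (N%:R * u 0 i).
have v0 i : 0 <= N%:R * u 0 i.
  by rewrite mulr_ge0 //; have /andP[] := cu i.
have mN i : (m i < N.+1)%N.
  rewrite ltnS -(ler_nat R) (@le_trans _ _ (N%:R * u 0 i)) ?truncn_le //.
  by rewrite -[leRHS]mulr1 ler_wpM2l //; have /andP[] := cu i.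
exists [ffun i => Ordinal (mN i)]; rewrite /hat lt_max; apply/orP; right.
rewrite [X in _ - X](_ : _ = 0); last first.
  apply/eqP; rewrite eq_le bigmax_ge_id andbT; apply: bigmax_le => // i _.
  by rewrite ffunE /= subr_le0 truncn_le.
rewrite subr0 subr_gt0; apply: bigmax_lt => // i _.
by rewrite ffunE /= ltrBlDr addrC natr1 truncnS_gt.
Qed.

Lemma cont_hat (Y : topologicalType) (F : Y -> 'rV[R]_k) z :
  cont F -> cont (fun y => hat z (F y)).
Proof.
move=> cF; apply: cont_max; first exact: cont_cst.
have cN i : cont (fun y => N%:R * F y 0 i : R).
  by apply: cont_mul; [exact: cont_cst|exact: cont_coord].
apply: cont_sub; [apply: cont_sub|]; first exact: cont_cst.
  apply: cont_big => [f g|i _]; first exact: cont_max.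
  by apply: cont_sub => //; exact: cont_cst.
apply: cont_big => [f g|i _]; first exact: cont_max.
by apply: cont_sub => //; exact: cont_cst.
Qed.

End Hats.

Section Approximation.
Variable R : realType.

Lemma cube_compact k : compact (@cube R k).
Proof.
have -> : @cube R k = [set u | forall i, `[0%R, 1%R]%classic (u ord0 i)].
  by apply/seteqP; split=> u /= cu i; have := cu i; rewrite in_itv.
by apply: (@rV_compact R k (fun=> `[0, 1]%classic)) => i; exact: segment_compact.
Qed.

(** Compactness in near-covering form. The conclusion is an eventuality in [d], so that finitely
    many functions can share one [d]. *)
Lemma cube_uniform_continuity k (F : 'rV[R]_k -> R) (e : R) : cont F -> 0 < e ->
  \forall d \near 0^'+, forall u, cube u -> forall u' : 'rV[R]_k,
    (forall i, `|u 0 i - u' 0 i| < d) -> `|F u - F u'| < e.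
Proof.
move=> cF e0.
have /compact_near_coveringP cK := @cube_compact k.
apply: (cK R 0^'+ (fun (d : R) (u : 'rV[R]_k) => forall u' : 'rV[R]_k,
    (forall i, `|u 0 i - u' 0 i| < d) -> `|F u - F u'| < e)) => u _.
have e20 : 0 < e / 2 by rewrite divr_gt0.
have /cvgrPdist_lt/(_ _ e20)/nbhs_ballP[r /= r0 hr] := cF u.
(* Half the radius bounds the move from [u] to [u1], the other half the move from [u1] to [u2]. *)
exists (ball u (r / 2), [set d | d < r / 2]) => /=.
  split; first by apply: nbhsx_ballx; rewrite divr_gt0.
  by apply: nbhs_right_lt; rewrite divr_gt0.
case=> u1 d /= [[_ u1r] dr] u2 u12.
have h1 : `|F u - F u1| < e / 2.
  apply: hr; split => // i j; rewrite ord1.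
  by have /= := u1r 0 j; rewrite /ball /=; lra.
have h2 : `|F u - F u2| < e / 2.
  apply: hr; split => // i j; rewrite ord1.
  have /= := u1r 0 j; rewrite /ball /= => v1; have := u12 j.
  have := ler_normD (u 0 j - u1 0 j) (u1 0 j - u2 0 j).
  rewrite addrA subrK; lra.
have := ler_normB (F u - F u2) (F u - F u1).
rewrite (_ : F u - F u2 - _ = F u1 - F u2); last by lra.
lra.
Qed.

Variables (S : finType) (K : simplicial_complex S).
Local Notation X := (realization R K).
Implicit Types (x : X) (q : S).

(** The coordinates sum to 1. The bound does not depend on [x], so a vertex chosen this way stays in
    the support under any perturbation smaller than the bound. *)
Lemma large_coordinate x : exists q, #|S|%:R^-1 <= bary x q.
Proof.
apply: contrapT => /forallNP h.
have S0 : (0 < #|S|)%N.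
  rewrite lt0n; apply/eqP => /card0_eq S0.
  have := bary_sum x; rewrite big1 => [/eqP|q _]; first by rewrite eq_sym oner_eq0.
  by have := S0 q.
have := bary_sum x; apply/eqP; rewrite lt_eqF //.
have -> : (1 : R) = \sum_(q : S) #|S|%:R^-1.
  by rewrite sumr_const -[RHS]mulr_natl divff // pnatr_eq0 -lt0n.
have /card_gt0P[q0 _] := S0.
apply: ltr_sum => [|q _]; last by rewrite ltNge; apply/negP/h.
by apply/hasP; exists q0 => //; exact: mem_index_enum.
Qed.

Lemma vertex_point (V : {set S}) q : V \in simplices K -> q \in V ->
  exists x, forall p, bary x p = (p == q)%:R.
Proof.
move=> VK qV.
(* A constant family over [R] is realized, and any of its values is the point. *)
have [|y p|y|y|h _ hE] := @realize R S K R (fun _ p => (p == q)%:R).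
- by move=> p; exact: cont_cst.
- exact: ler0n.
- by exists V => // p; case: eqP => [->//|_]; rewrite ltxx.
- by exists q; rewrite eqxx ltr01.
exists (h 0) => p; rewrite hE (bigD1 q) //= eqxx big1 ?addr0 ?divr1 //.
by move=> i /negbTE ->.
Qed.

End Approximation.

Section SkeletalApproximation.
Variables (R : realType) (S : finType) (K : simplicial_complex S).
Local Notation X := (realization R K).

(** Each grid point is labelled by a large coordinate of its image under [F]. The mesh is so fine
    that the labels of the grid points around [u] all lie in [supp (F u)], and there are at most
    [k + 1] such points by [card_hat]. Interpolating the labels by the hats gives [g]. *)
Lemma skeletal_approximation k (F : 'rV[R]_k -> X) (x0 : X) :
  cont F ->
  (forall u : 'rV[R]_k, (exists i, u 0 i <= 1/4 \/ 3/4 <= u 0 i) -> F u = x0) ->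
  exists (g : 'rV[R]_k -> X) (y0 : X),
    [/\ cont g,
        forall u, cube u -> supp (g u) \subset supp (F u),
        forall u, cube u -> (#|supp (g u)| <= k.+1)%N,
        supp y0 \subset supp x0 /\ (#|supp y0| <= k.+1)%N
      & forall u, cube u -> (exists i, u 0 i < 1/8 \/ 7/8 < u 0 i) ->
          g u = y0].
Proof.
move=> cF Fx0; have [label labelP] := choice (@large_coordinate R S K).
have S0 : 0 < #|S|%:R^-1 :> R.
  by rewrite invr_gt0 ltr0n; apply/card_gt0P; exists (label x0).
(* The bound [d < 1/8] puts the grid points around the collar of width 1/8 into the collar of width
   1/4, where [F] is constant. *)
have [d [d0 [d8 dP]]] : exists d : R, 0 < d /\ d < 1/8 /\
    forall q (u : 'rV[R]_k), cube u -> forall u' : 'rV[R]_k,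
      (forall i, `|u 0 i - u' 0 i| < d) ->
      `|bary (F u) q - bary (F u') q| < #|S|%:R^-1.
  apply: (@filter_ex _ (0^'+ : set_system R)).
  near=> d; split; first by near: d; exact: nbhs_right_gt.
  split; first by near: d; apply: nbhs_right_lt; lra.
  near: d; apply: filter_forall => q.
  apply: (@cube_uniform_continuity R k (fun u => bary (F u) q)) => //.
  exact: cont_bary.
pose N := (Num.truncn d^-1).+1.
have dN : N%:R^-1 < d.
  by rewrite -[d]invrK ltf_pV2 ?truncnS_gt // posrE ?ltr0n // invr_gt0.
have N0 : 0 < N%:R :> R by rewrite ltr0n.
pose grid (z : {ffun 'I_k -> 'I_N.+1}) : 'rV[R]_k := \row_i ((z i)%:R / N%:R).
have cgrid z : cube (grid z).
  move=> i; rewrite mxE divr_ge0 //= ler_pdivrMr // mul1r ler_nat.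
  by rewrite -ltnS ltn_ord.
pose lab z := label (F (grid z)).
pose w u q : R := \sum_(z | lab z == q) hat z (clamp_row u).
have w_hat u q : 0 < w u q -> exists2 z, lab z = q & 0 < hat z (clamp_row u).
  move=> wq; apply: contrapT => h; move: wq; rewrite /w big1 ?ltxx // => z /eqP zq.
  apply/eqP; rewrite eq_le hat_ge0 andbT leNgt; apply/negP => hz.
  by apply: h; exists z.
have hat_w u z : 0 < hat z (clamp_row u) -> 0 < w u (lab z).
  move=> hz; rewrite /w (bigD1 z) //= ltr_pwDl //.
  by apply: sumr_ge0 => *; exact: hat_ge0.
have hat_grid u z : 0 < hat z u -> forall i, `|u 0 i - grid z 0 i| < N%:R^-1.
  by move=> hz i; rewrite mxE; exact: hat_near.
have w_supp u q : 0 < w u q -> q \in supp (F (clamp_row u)).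
  case/w_hat => z <- hz; rewrite in_supp.
  have := labelP (F (grid z)).
  have := dP (lab z) _ (clamp_row_cube u) (grid z).
  move=> /(_ (fun i => lt_trans (hat_grid _ _ hz i) dN)).
  by rewrite ltr_norml -/(lab z); lra.
have [||||g cg gE] := @realize R S K 'rV[R]_k w.
- move=> q; apply: cont_big => [f f'|z _]; first exact: cont_add.
  by apply: cont_hat; apply: cont_clamp_row => u; exact: cvg_id.
- by move=> u q; apply: sumr_ge0 => *; exact: hat_ge0.
- move=> u; exists (supp (F (clamp_row u))); first exact: supp_simplex.
  exact: w_supp.
- move=> u; have [z hz] := @hat_exists R k N _ (clamp_row_cube u).
  by exists (lab z); exact: hat_w.
have w0 u q : 0 <= w u q by apply: sumr_ge0 => *; exact: hat_ge0.
have sg u q : q \in supp (g u) -> 0 < w u q.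
  rewrite inE gE mulf_eq0 negb_or => /andP[wq _].
  by rewrite lt_neqAle eq_sym wq w0.
(* On the thinner collar all labels agree, so that [g] is constantly the vertex [label x0] there. *)
have q0x : label x0 \in supp x0 by rewrite in_supp (lt_le_trans S0) // labelP.
have [y0 y0E] := vertex_point R (supp_simplex x0) q0x.
have sy0 p : (p \in supp y0) = (p == label x0).
  by rewrite inE y0E pnatr_eq0 eqb0 negbK.
exists g, y0; split => //.
- move=> u cu; apply/fintype.subsetP => q /sg/w_supp.
  by rewrite clamp_row_id.
- move=> u cu; apply: leq_trans (card_hat N u).
  apply: leq_trans (leq_imset_card lab _).
  apply/subset_leq_card/fintype.subsetP => q /sg/w_hat[z zq].
  by rewrite clamp_row_id // => hz; apply/imsetP; exists z; rewrite ?inE.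
- split; first by apply/fintype.subsetP => p; rewrite sy0 => /eqP ->.
  rewrite (_ : supp y0 = [set label x0]%SET) ?cards1 //.
  by apply/setP => p; rewrite sy0 finset.in_set1.
- move=> u cu [i ui].
  have labq0 z : 0 < hat z (clamp_row u) -> lab z = label x0.
    rewrite clamp_row_id // => /hat_grid/(_ i); rewrite ltr_norml => zi.
    rewrite /lab Fx0 //; exists i; case: ui => ui; [left|right]; lra.
  have wq0 p : p != label x0 -> w u p = 0.
    move=> pq; apply/eqP; rewrite eq_le w0 andbT leNgt; apply/negP.
    by move=> /w_hat[z zp /labq0]; rewrite zp => /eqP; rewrite (negbTE pq).
  apply: bary_inj => p; rewrite y0E gE (bigD1 (label x0)) //= [X in _ + X]big1.
    have [->|pq] := eqVneq p (label x0); last by rewrite wq0 // mul0r.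
    rewrite addr0 divff //; have [z hz] := @hat_exists R k N _ (clamp_row_cube u).
    by rewrite gt_eqF // -(labq0 _ hz); exact: hat_w.
  by move=> q qq0; exact: wq0.
Unshelve. all: end_near.
Qed.

End SkeletalApproximation.

(** * A connectivity criterion *)

Section Sweep.
Variables (R : realType) (S : finType) (K : simplicial_complex S).
Local Notation X := (realization R K).
Variables (G : {set S} -> {set S}) (n : nat).
Hypothesis G_anti : forall V W : {set S}, V \in simplices K -> W \subset V ->
  G V \subset G W.
Hypothesis G_join : forall V, V \in simplices K -> V :|: G V \in simplices K.
Hypothesis G_set0 : G finset.set0 \in simplices K.
Hypothesis G_neq0 : forall V, V \in simplices K -> (#|V| <= n.+1)%N ->
  G V != finset.set0.
Implicit Types (x y : X) (q a : S) (t : R).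

Local Notation A := (G finset.set0).

Lemma G_sub0 V : V \in simplices K -> G V \subset A.
Proof. by move=> VK; apply: G_anti => //; exact: finset.sub0set. Qed.

(* The infimum of the [t] such that [a \in G [set q | t < bary x q]]. *)
Definition threshold a x : R :=
  \big[Num.max/0]_(W in simplices K | a \notin G W)
    \big[Num.min/1]_(q in W) bary x q.

Lemma threshold_ge0 a x : 0 <= threshold a x.
Proof. exact: bigmax_ge_id. Qed.

(** Otherwise the superlevel set [V], nonempty because [a \in A], takes part in the maximum, and its
    least coordinate is at least [t]. *)
Lemma threshold_lt a x t : a \in A -> 0 <= t <= 1 -> threshold a x < t ->
  a \in G [set q | t < bary x q]%SET.
Proof.
move=> aA /andP[t0 t1]; apply: contraLR => aV; rewrite -leNgt.
set V := [set q | _]%SET in aV *.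
have V0 : V != finset.set0 by apply: contraNneq aV => ->.
have VK : V \in simplices K.
  apply: (simplex_face (supp_simplex x)) => //.
  by apply/fintype.subsetP => q; rewrite inE in_supp; exact: le_lt_trans.
apply: (@le_trans _ _ (\big[Num.min/1]_(q in V) bary x q)).
  by apply: le_bigmin => // q; rewrite inE => /ltW.
apply: (@le_bigmax_cond _ _ _ _ V _
  (fun W : {set S} => \big[Num.min/1]_(q in W) bary x q)).
by rewrite VK aV.
Qed.

(** If [a \notin G W], monotonicity keeps [W] from lying inside [supp x], so [W] contains a vertex
    with coordinate 0. *)
Lemma threshold_eq0 a x : a \in G (supp x) -> threshold a x = 0.
Proof.
move=> aG; apply/eqP; rewrite eq_le threshold_ge0 andbT.
apply: bigmax_le => // W /andP[WK aW].
have /subsetPn[q qW qx] : ~~ (W \subset supp x).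
  by apply: contraNN aW => /(G_anti (supp_simplex x))/fintype.subsetP; apply.
apply: (@bigmin_inf _ _ _ _ q) => //.
by move: qx; rewrite in_supp -leNgt.
Qed.

(* Truncating [bary x] at height [t] leaves a simplex [V] that shrinks as [t]
   grows; a vertex [a] of [A] receives weight as soon as it lies in [G V]. *)
Definition retract_weight x t q : R :=
  Num.max 0 (bary x q - t) + (q \in A)%:R * Num.max 0 (t - threshold q x).

Lemma retract_weight_ge0 x t q : 0 <= retract_weight x t q.
Proof. by rewrite addr_ge0 ?mulr_ge0 // le_max lexx. Qed.

Lemma retract_weight0 x q : retract_weight x 0 q = bary x q.
Proof.
rewrite /retract_weight subr0 sub0r [Num.max 0 (- _)]max_l; last first.
  by rewrite oppr_le0 threshold_ge0.
by rewrite mulr0 addr0 max_r // bary_ge0.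
Qed.

Lemma retract_weight_gt0 x t q : 0 <= t <= 1 -> 0 < retract_weight x t q ->
  t < bary x q \/ q \in G [set p | t < bary x p]%SET.
Proof.
move=> t01; have [xq|xq] := ltP t (bary x q); first by left.
rewrite /retract_weight max_l ?subr_le0 // add0r.
case: (boolP (q \in A)) => qA; last by rewrite mul0r ltxx.
rewrite mul1r lt_max ltxx /= subr_gt0 => ?; right; exact: threshold_lt.
Qed.

Lemma retract_weight_simplex x t : 0 <= t <= 1 ->
  exists2 V, V \in simplices K & forall q, 0 < retract_weight x t q -> q \in V.
Proof.
move=> t01; pose V := [set p | t < bary x p]%SET.
exists (V :|: G V)%SET; last first.
  by move=> q /(retract_weight_gt0 t01)[xq|qG]; rewrite !inE ?xq ?qG ?orbT.
have [->|V0] := eqVneq V finset.set0; first by rewrite finset.set0U.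
apply: G_join; apply: (simplex_face (supp_simplex x)) => //.
apply/fintype.subsetP => q; rewrite inE in_supp; apply: le_lt_trans.
by have /andP[] := t01.
Qed.

(** For [t > 0], a vertex of [G (supp x)] has threshold 0 and hence weight at least [t]; this is
    where the bound on the support enters. *)
Lemma retract_weight_neq0 x t : 0 <= t -> (#|supp x| <= n.+1)%N ->
  exists2 q, 0 < retract_weight x t q & (0 < t -> q \in A).
Proof.
rewrite le_eqVlt => /predU1P[<- _|t0 xn].
  have /finset.set0Pn[q qx] := simplex_nonempty (supp_simplex x).
  by exists q; rewrite ?ltxx // retract_weight0 -in_supp.
have /finset.set0Pn[a aG] := G_neq0 (supp_simplex x) xn.
have aA : a \in A by apply: (fintype.subsetP (G_sub0 (supp_simplex x))).
exists a => //; rewrite /retract_weight aA mul1r threshold_eq0 // subr0.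
by rewrite ltr_wpDl // ?le_max ?lexx // lt_max t0 orbT.
Qed.

Lemma cont_retract_weight (Y : topologicalType) (h : Y -> X) (b : Y -> R) q :
  cont h -> cont b -> cont (fun z => retract_weight (h z) (b z) q).
Proof.
move=> ch cb; apply: cont_add.
  apply: cont_max; first exact: cont_cst.
  by apply: cont_sub => //; exact: cont_bary.
apply: cont_mul; first exact: cont_cst.
apply: cont_max; first exact: cont_cst.
apply: cont_sub => //; apply: cont_big => [f g|W _]; first exact: cont_max.
apply: cont_big => [f g|p _]; first exact: cont_min.
exact: cont_bary.
Qed.

Variable a0 : S.
Hypothesis a0A : a0 \in A.

(* For [t] in [0, 1] this runs linearly from [x] to [y]; in [1, 2] it moves [y]
   into the simplex [A]; in [2, 3] it contracts [A] to the vertex [a0]. *)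
Definition sweep_weight t x y q : R :=
  (1 - clamp (t - 2)) *
    ((1 - clamp t) * bary x q
     + clamp t * retract_weight y (clamp (t - 1)) q)
  + clamp (t - 2) * (q == a0)%:R.

Lemma sweep_weight0 x y q : sweep_weight 0 x y q = bary x q.
Proof.
rewrite /sweep_weight !clamp_le0; [|lra|lra|lra].
by rewrite !subr0 !mul1r !mul0r !addr0.
Qed.

Lemma sweep_weight3 x y q : sweep_weight 3 x y q = (q == a0)%:R.
Proof.
rewrite /sweep_weight [clamp (3 - 2)]clamp_ge1; last by lra.
by rewrite subrr mul0r add0r mul1r.
Qed.

Lemma sweep_weight_ge0 t x y q : 0 <= sweep_weight t x y q.
Proof.
have c01 s : 0 <= clamp s /\ 0 <= 1 - clamp s :> R.
  by have /andP[c0 c1] := clamp_itv s; rewrite subr_ge0.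
have [[? ?] [? ?]] := (c01 (t - 2), c01 t).
rewrite /sweep_weight; apply: addr_ge0; last by rewrite mulr_ge0.
apply: mulr_ge0 => //; apply: addr_ge0; apply: mulr_ge0 => //.
  exact: bary_ge0.
exact: retract_weight_ge0.
Qed.

(** The three phases are carried by [supp x], by the simplices of [retract_weight_simplex], and by
    [A], since cutting at height 1 removes every barycentric coordinate. *)
Lemma sweep_weight_simplex t x y :
  supp y \subset supp x -> (#|supp y| <= n.+1)%N ->
  (exists2 V, V \in simplices K & forall q, 0 < sweep_weight t x y q -> q \in V) /\
  exists q, 0 < sweep_weight t x y q.
Proof.
move=> /fintype.subsetP yx yn; have /andP[c0 c1] := clamp_itv t.
have /andP[d0 d1] := clamp_itv (t - 2).
have [t1|t1] := leP t 1.
  rewrite /sweep_weight [clamp (t - 2)]clamp_le0; last by lra.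
  rewrite [clamp (t - 1)]clamp_le0; last by lra.
  have pos q : q \in supp y ->
      0 < (1 - clamp t) * bary x q + clamp t * bary y q.
    move=> qy; have := yx q qy; rewrite !in_supp in qy * => qx.
    have [->|ct] := eqVneq (clamp t) 1; first by rewrite subrr mul0r add0r mul1r.
    rewrite ltr_pwDl ?mulr_ge0 // ?(ltW qy) // mulr_gt0 // subr_gt0.
    by rewrite lt_neqAle ct.
  split.
    exists (supp x); first exact: supp_simplex.
    move=> q; rewrite subr0 mul1r mul0r addr0 retract_weight0.
    apply: contraTT => qx; rewrite -leNgt.
    have qy : q \notin supp y by apply: contra qx; exact: yx.
    move: qx qy; rewrite !inE !negbK => /eqP -> /eqP ->.
    by rewrite !mulr0 addr0.
  have /finset.set0Pn[q qy] := simplex_nonempty (supp_simplex y).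
  by exists q; rewrite subr0 mul1r mul0r addr0 retract_weight0 pos.
have [t2|t2] := leP t 2.
  rewrite /sweep_weight [clamp (t - 2)]clamp_le0; last by lra.
  rewrite [clamp t]clamp_ge1 ?(ltW t1) //.
  have c01 := clamp_itv (t - 1).
  split.
    have [V VK VP] := retract_weight_simplex y c01; exists V => // q.
    by rewrite subr0 mul1r subrr !mul0r mul1r addr0 add0r; exact: VP.
  have /andP[c10 _] := c01.
  have [q qP _] := retract_weight_neq0 c10 yn; exists q.
  by rewrite subr0 mul1r subrr !mul0r mul1r addr0 add0r.
rewrite /sweep_weight [clamp t]clamp_ge1; last by lra.
rewrite [clamp (t - 1)]clamp_ge1; last by lra.
have [r rP /(_ ltr01) rA] := retract_weight_neq0 ler01 yn.
split.
  exists A => // q; rewrite subrr mul0r mul1r add0r; apply: contraTT => qA.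
  have qa0 : q == a0 = false by apply: contraNF qA => /eqP ->.
  rewrite /retract_weight (negbTE qA) mul0r addr0 max_l ?subr_le0 ?bary_le1 //.
  by rewrite qa0 !mulr0 addr0 ltxx.
have [e|ct] := eqVneq (clamp (t - 2)) 1.
  by exists a0; rewrite e subrr mul0r add0r eqxx mulr1.
exists r; rewrite subrr mul0r mul1r add0r ltr_pwDl ?mulr_ge0 //.
by rewrite mulr_gt0 // subr_gt0 lt_neqAle ct.
Qed.

(** [Y] is arbitrary because the sweep is run both over the time line, for the base point, and over
    time and cube, for the map. *)
Lemma sweep (Y : topologicalType) (b : Y -> R) (x y : Y -> X) :
  cont b -> cont x -> cont y ->
  (forall z, supp (y z) \subset supp (x z)) ->
  (forall z, (#|supp (y z)| <= n.+1)%N) ->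
  exists2 h : Y -> X, cont h & forall z q, bary (h z) q =
    sweep_weight (b z) (x z) (y z) q / \sum_p sweep_weight (b z) (x z) (y z) p.
Proof.
move=> cb cx cy yx yn; apply: realize.
- move=> q; have cbs (s : R) : cont (fun z => clamp (b z - s)).
    by apply: cont_clamp; apply: cont_sub => //; exact: cont_cst.
  have cb0 : cont (fun z => clamp (b z)) by exact: cont_clamp.
  have c1 : cont (fun _ : Y => 1 : R) by exact: cont_cst.
  apply: cont_add; last by apply: cont_mul => //; exact: cont_cst.
  apply: cont_mul; first exact: cont_sub.
  apply: cont_add; apply: cont_mul => //.
  + exact: cont_sub.
  + exact: cont_bary.
  + exact: cont_retract_weight.
- by move=> *; exact: sweep_weight_ge0.
- by move=> z; have [] := sweep_weight_simplex (b z) (yx z) (yn z).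
- by move=> z; have [] := sweep_weight_simplex (b z) (yx z) (yn z).
Qed.

Lemma sum_sweep_weight0 x y : \sum_p sweep_weight 0 x y p = 1.
Proof. by under eq_bigr do rewrite sweep_weight0; exact: bary_sum. Qed.

End Sweep.

(** * Null-homotopies of cube maps *)

Section Vanishing.
Variables (R : realType) (S : finType) (K : simplicial_complex S).
Local Notation X := (realization R K).
(** The cube is stretched about its center by the factor [1 + s] and clamped: at [s = 1] the middle
    half fills the cube and the rest goes to the boundary. *)
Lemma homotopic_collar k (x0 : X) (f : 'rV[R]_k -> X) : sphere_map x0 f ->
  exists F : 'rV[R]_k -> X, [/\ cont F,
    forall u : 'rV[R]_k, (exists i, u 0 i <= 1/4 \/ 3/4 <= u 0 i) -> F u = x0
    & homotopic x0 f F].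
Proof.
move=> [cf fb].
pose E (z : R * 'rV[R]_k) := clamp_row (\row_i ((1 + z.1) * z.2 0 i - z.1 / 2)).
have cE : cont E.
  apply: cont_clamp_row; apply: cont_row => i; apply: cont_sub; apply: cont_mul.
  - by apply: cont_add; [exact: cont_cst|exact: cont_fst].
  - exact/cont_coord/cont_snd.
  - exact: cont_fst.
  - exact: cont_cst.
have cfE : cont (fun z => f (E z)).
  by apply: (cont_within_comp cf) => // z; exact: clamp_row_cube.
have fE (s : R) (u : 'rV[R]_k) i : (1 + s) * u 0 i - s / 2 <= 0 \/ 1 <= (1 + s) * u 0 i - s / 2 ->
    f (E (s, u)) = x0.
  move=> h; apply: fb; split; first exact: clamp_row_cube.
  by exists i; rewrite !mxE; case: h => h; [left; rewrite clamp_le0|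
    right; rewrite clamp_ge1].
exists (fun u => f (E (1, u))); split.
- apply: (@cont_comp _ _ _ (fun u : 'rV[R]_k => (1 : R, u)) (fun z => f (E z))) => //.
  by apply: cont_pair; [exact: cont_cst|move=> u; exact: cvg_id].
- by move=> u [i ui]; apply: (fE _ _ i); case: ui => ui; [left|right]; lra.
- apply: (@cont_homotopic _ _ _ _ _ _ (fun z => f (E z))) => //.
  + move=> u cu; congr f; rewrite /E -[RHS](clamp_row_id cu); congr clamp_row.
    by apply/rowP => i; rewrite mxE /= addr0 mul1r mul0r subr0.
  + move=> t u t01 [cu [i ui]]; apply: (fE _ _ i).
    by case: ui => ->; [left|right]; rewrite ?mulr0 ?mulr1; lra.
Qed.

(** A scaled distance to the boundary, with the factor 8 matching the collar of width 1/8 on which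
    the map of [skeletal_approximation] is constant. *)
Definition depth k (u : 'rV[R]_k) : R :=
  \big[Num.min/1]_i clamp (8 * Num.min (u 0 i) (1 - u 0 i)).

Lemma cont_depth (Y : topologicalType) k (h : Y -> 'rV[R]_k) :
  cont h -> cont (fun y => depth (h y)).
Proof.
move=> ch; apply: cont_big => [f g|i _]; first exact: cont_min.
apply: cont_clamp; apply: cont_mul; first exact: cont_cst.
have chi : cont (fun y => h y 0 i) by exact: cont_coord.
apply: cont_min => //.
by apply: cont_sub => //; exact: cont_cst.
Qed.

Lemma depth_boundary k (u : 'rV[R]_k) : cube_boundary u -> depth u = 0.
Proof.
move=> [cu [i ui]]; apply/eqP; rewrite eq_le; apply/andP; split.
  apply: (@bigmin_inf _ _ _ _ i) => //; rewrite clamp_le0 //.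
  by case: ui => ->; rewrite ?subr0 ?subrr minEle ?ler01 ?ler10 ?mulr0.
by apply: le_bigmin => // j _; have /andP[] := clamp_itv (8 * Num.min (u 0 j) (1 - u 0 j)).
Qed.

Lemma depth_core k (u : 'rV[R]_k) :
  ~ (exists i, u 0 i < 1/8 \/ 7/8 < u 0 i) -> depth u = 1.
Proof.
move=> h; apply/eqP; rewrite eq_le bigmin_le_id /=.
apply: le_bigmin => // i _; rewrite clamp_ge1 //.
have [u1|u1] := ltP (u 0 i) (1/8); first by case: h; exists i; left.
have [u2|u2] := ltP (7/8) (u 0 i); first by case: h; exists i; right.
by rewrite minEle; case: ifP => _; lra.
Qed.

Variables (G : {set S} -> {set S}) (n : nat).
Hypothesis G_anti : forall V W : {set S}, V \in simplices K -> W \subset V ->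
  G V \subset G W.
Hypothesis G_join : forall V, V \in simplices K -> V :|: G V \in simplices K.
Hypothesis G_set0 : G finset.set0 \in simplices K.
Hypothesis G_neq0 : forall V, V \in simplices K -> (#|V| <= n.+1)%N ->
  G V != finset.set0.

(** The sweep would move the boundary, so its time is multiplied by [depth]. Its final map depends
    only on [depth]: the core has arrived at [a0], and the collar follows the track [p] of the base
    point. This path is then rewound to its start. *)
Lemma sphere_map_null k (x0 : X) (f : 'rV[R]_k -> X) : (k <= n)%N ->
  sphere_map x0 f -> homotopic x0 f (cst x0).
Proof.
move=> kn /homotopic_collar[F [cF Fx0 fF]]; apply: (homotopic_trans fF).
have [g [y0 [cg gF gk [y0x0 y0k] gy0]]] := skeletal_approximation cF Fx0.
have /finset.set0Pn[a0 a0A] := simplex_nonempty G_set0.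
have kn1 : (k.+1 <= n.+1)%N by [].
have cid : cont (fun t : R => t) by move=> t; exact: cvg_id.
have [p cp pE] := sweep G_anti G_join G_set0 G_neq0 a0A
  cid (@cont_cst _ _ x0) (@cont_cst _ _ y0) (fun=> y0x0)
  (fun=> leq_trans y0k kn1).
have crow : cont (fun z : R * 'rV[R]_k => clamp_row z.2).
  exact/cont_clamp_row/cont_snd.
have cdepth : cont (fun z : R * 'rV[R]_k => depth z.2).
  exact/cont_depth/cont_snd.
have c3 : cont (fun _ : R * 'rV[R]_k => 3 : R) by exact: cont_cst.
have cb : cont (fun z : R * 'rV[R]_k => 3 * (z.1 * depth z.2) : R).
  by apply: cont_mul => //; apply: cont_mul => //; exact: cont_fst.
have gFrow (z : R * 'rV[R]_k) :
    supp (g (clamp_row z.2)) \subset supp (F (clamp_row z.2)).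
  by apply: gF; exact: clamp_row_cube.
have gkrow (z : R * 'rV[R]_k) : (#|supp (g (clamp_row z.2))| <= n.+1)%N.
  exact: leq_trans (gk _ (clamp_row_cube _)) kn1.
have [h ch hE] := sweep G_anti G_join G_set0 G_neq0 a0A
  cb (cont_comp crow cF) (cont_comp crow cg) gFrow gkrow.
have h0 z : z.1 * depth z.2 = 0 -> h z = F (clamp_row z.2).
  move=> z0; apply: bary_inj => q.
  by rewrite hE z0 mulr0 sum_sweep_weight0 sweep_weight0 divr1.
have p0 : p 0 = x0.
  by apply: bary_inj => q; rewrite pE sum_sweep_weight0 sweep_weight0 divr1.
have Fb u : cube_boundary u -> F u = x0.
  by move=> [_ [i ui]]; apply: Fx0; exists i; case: ui => ->; [left|right]; lra.
apply: (@homotopic_trans _ _ _ _ _ _ (fun u => p (3 * depth u))).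
  apply: (cont_homotopic ch).
  - by move=> u cu; rewrite h0 ?clamp_row_id //= mul0r.
  - move=> u cu; apply: bary_inj => q; rewrite hE pE /= mul1r clamp_row_id //.
    have [ue|uc] := pselect (exists i, u 0 i < 1/8 \/ 7/8 < u 0 i).
      rewrite gy0 // Fx0 //; have [i ui] := ue.
      by exists i; case: ui => ?; [left|right]; lra.
    rewrite depth_core // mulr1 !sweep_weight3.
    by congr (_ / _); apply: eq_bigr => r _; rewrite !sweep_weight3.
  - move=> t u _ bu; have [cu _] := bu.
    by rewrite h0 /= ?depth_boundary ?mulr0 // clamp_row_id // Fb.
apply: (@cont_homotopic _ _ _ _ _ _ (fun z => p (3 * ((1 - z.1) * depth z.2)))).
- apply: (@cont_comp _ R _ (fun z : R * 'rV[R]_k => 3 * ((1 - z.1) * depth z.2)) p) => //.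
  apply: cont_mul => //; apply: cont_mul => //.
  by apply: cont_sub; [exact: cont_cst|exact: cont_fst].
- by move=> u _; rewrite /= subr0 mul1r.
- by move=> u _; rewrite /= subrr mul0r mulr0 p0.
- by move=> t u _ bu; rewrite /= depth_boundary // !mulr0 p0.
Qed.

Lemma vanishing_criterion k (x0 : X) : (k <= n)%N -> homotopy_group_vanishes R k x0.
Proof.
move=> kn; have cs : @sphere_map R X k x0 (cst x0).
  by split => //; apply: continuous_subspaceT; exact: cst_continuous.
apply/seteqP; split => [_ [f fs <-]|_ ->]; last by exists (cst x0).
have fc := sphere_map_null kn fs; apply/seteqP; split => g [gs fg]; split => //.
  exact: homotopic_trans (homotopic_sym fc) fg.
exact: homotopic_trans fc fg.
Qed.

End Vanishing.

(** * Free spokes in the Morse complex *)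

Section FunctionalRelation.
Variables (T : finType) (e : rel T).
Hypothesis e_fun : forall x y y', e x y -> e x y' -> y = y'.

(** Every step is forced, so of two paths from [x] one is an initial part of the other, and a sink
    ends both. *)
Lemma connect_sink_unique x w w' : connect e x w -> connect e x w' ->
  (forall y, ~~ e w y) -> (forall y, ~~ e w' y) -> w = w'.
Proof.
move=> /connectP[p + ->] /connectP[p' + ->].
elim: p x p' => [|y p IH] x [|y' p'] //=.
- by move=> _ /andP[xy' _] /(_ y'); rewrite xy'.
- by move=> /andP[xy _] _ _ /(_ y); rewrite xy.
by move=> /andP[xy yp] /andP[/(e_fun xy) <- yp']; exact: IH.
Qed.

End FunctionalRelation.

Section Spokes.
Variables (T : finType) (Delta : simplicial_complex T) (v : T).
Implicit Types (x y w : T) (s : {set T}) (q : {set T} * {set T}).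
Implicit Types V W : {set {set T} * {set T}}.

Lemma proper_pair x y s : s \proper [set x; y]%SET -> s != finset.set0 ->
  s <> [set x]%SET -> s = [set y]%SET.
Proof.
move=> sp s0 sx; have := proper_card sp.
rewrite cards2 => /leq_trans/(_ (leq_b1 _ : (x != y).+1 <= 2)%N); rewrite ltnS => s1.
have /cards1P[z zs] : (#|s| == 1)%N by rewrite eqn_leq s1 card_gt0.
have := proper_sub sp; rewrite zs finset.sub1set !inE => /orP[]/eqP zE.
  by case: sx; rewrite zs zE.
by rewrite zE.
Qed.

Lemma pair_set_inj x y y' : y != x -> [set x; y]%SET = [set x; y']%SET -> y = y'.
Proof.
move=> yx /setP/(_ y); rewrite !inE eqxx orbT (negbTE yx) /=.
by move=> /esym/eqP.
Qed.

Lemma set1_neq_pair x y y' : y' != y -> [set x]%SET <> [set y; y']%SET.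
Proof. by move=> yy' /(congr1 (fun s => #|s|)); rewrite cards1 cards2 eq_sym yy'. Qed.

Lemma sdim0P s : s != finset.set0 -> sdim s = 0%N -> exists x, s = [set x]%SET.
Proof.
rewrite -card_gt0 /sdim => s0 s1; apply/cards1P.
by case: #|s| s0 s1 => //= n _ ->.
Qed.

Lemma sdim1P x s : x \in s -> sdim s = 1%N -> exists2 y, y != x & s = [set x; y]%SET.
Proof.
rewrite /sdim => xs s1; have /cards2P[a [b [ab sE]]] : (#|s| == 2)%N.
  by case: #|s| s1 => // n /= ->.
move: xs; rewrite sE !inE => /orP[]/eqP ->; first by exists b; rewrite 1?eq_sym.
by exists a; rewrite // finset.setUC.
Qed.

Definition spoke w : {set T} * {set T} := ([set w], [set v; w])%SET.

Definition neighbors : {set T} := [set w | (w != v) && ([set v; w]%SET \in simplices Delta)]%SET.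

Lemma degree_le_neighbors : (degree (skeleton 1 Delta) v <= #|neighbors|)%N.
Proof.
apply: leq_trans (leq_imset_card (fun w => [set v; w]%SET) _).
apply/subset_leq_card/fintype.subsetP => e.
rewrite !inE => /andP[/andP[eD _] /andP[/eqP e1 ve]].
have [y yv eE] := sdim1P ve e1; apply/imsetP; exists y => //.
by rewrite inE yv -eE.
Qed.

Lemma spoke_primitive w : w \in neighbors -> primitive_dvf Delta (spoke w).
Proof.
rewrite inE => /andP[wv vwD]; have wvw : [set w]%SET \subset [set v; w]%SET.
  by rewrite finset.sub1set !inE eqxx orbT.
split => //=; last by rewrite /sdim cards1 cards2 eq_sym wv.
apply: (simplex_face vwD) => //; apply/finset.set0Pn; exists w; exact: finset.set11.
Qed.

Lemma spoke_occurs s w w' : w \in neighbors -> w' \in neighbors ->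
  occurs_in s (spoke w) -> occurs_in s (spoke w') -> w = w'.
Proof.
rewrite !inE => /andP[wv _] /andP[wv' _] [] -> [] /=.
- exact: finset.set1_inj.
- by move=> /(set1_neq_pair wv').
- by move=> /esym/(set1_neq_pair wv).
- exact: pair_set_inj.
Qed.

(** The directed graph of the steps of [V]-paths in dimension 0. *)
Definition arrow V : rel T :=
  [rel x y | (y != x) && (([set x], [set x; y])%SET \in V)].

(** The first disjunct keeps a spoke that already belongs to [V] from clashing with itself. *)
Definition compatible V q : bool :=
  [forall q' in V, (q' == q) ||
    (q.1 \notin [:: q'.1; q'.2]) && (q.2 \notin [:: q'.1; q'.2])].

(** A spoke adds an arrow from [w] to [v], which would close a cycle if [v] already led to [w]. *)
Definition free_spokes V : {set {set T} * {set T}} :=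
  [set spoke w | w in neighbors & compatible V (spoke w)
                                 && ~~ connect (arrow V) v w]%SET.

Lemma free_spokesP V q : reflect
  (exists2 w, q = spoke w &
    [/\ w \in neighbors, compatible V (spoke w) & ~~ connect (arrow V) v w])
  (q \in free_spokes V).
Proof.
apply: (iffP imsetP) => -[w].
  by rewrite inE => /andP[wn /andP[wc wv]] ->; exists w.
by move=> -> [wn wc wv]; exists w; rewrite // inE wn wc.
Qed.

(** A smaller field has fewer clashes and fewer arrows. *)
Lemma free_spokes_anti V W : W \subset V -> free_spokes V \subset free_spokes W.
Proof.
move=> /fintype.subsetP WV; apply/fintype.subsetP => q /free_spokesP[w -> [wn wc wv]].
apply/free_spokesP; exists w => //; split => //.
  apply/forall_inP => q' /WV q'V; exact: (forall_inP wc).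
apply: contra wv; apply: connect_sub => x y /andP[yx xyW].
by apply: connect1; rewrite /arrow /= yx WV.
Qed.

Lemma free_spokes0 : free_spokes finset.set0 = [set spoke w | w in neighbors]%SET.
Proof.
apply/setP => q; apply/free_spokesP/imsetP => [[w -> [wn _ _]]|[w wn ->]].
  by exists w.
exists w => //; split => //; first by apply/forall_inP => q'; rewrite inE.
apply/negP => /connectP[[|y p] /=]; last by rewrite /arrow /= inE andbF.
by move=> _ wE; move: wn; rewrite inE wE eqxx.
Qed.

(** Compatibility rules out clashes with [V], and [spoke_occurs] rules out clashes between
    spokes. *)
Lemma dvf_free_spokes V : discrete_vector_field Delta V ->
  discrete_vector_field Delta (V :|: free_spokes V)%SET.
Proof.
move=> [prV unV]; split.
  move=> q; rewrite inE => /orP[/prV//|/free_spokesP[w -> [wn _ _]]].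
  exact: spoke_primitive.
have VG s q w : q \in V -> compatible V (spoke w) ->
    occurs_in s q -> occurs_in s (spoke w) -> q = spoke w.
  move=> qV /forall_inP/(_ _ qV)/orP[/eqP//|/andP[]].
  by rewrite !inE !negb_or => /andP[/eqP n11 /eqP n12] /andP[/eqP n21 /eqP n22]
    [] -> [] e; [case: n11|case: n21|case: n12|case: n22].
move=> s q q' sD; rewrite !inE => /orP[qV|/free_spokesP[w -> [wn wc _]]]
  /orP[q'V|/free_spokesP[w' -> [wn' wc' _]]] sq sq'.
- exact: unV sD qV q'V sq sq'.
- exact: VG sq sq'.
- by apply/esym; exact: VG sq' sq.
- by rewrite (spoke_occurs wn wn' sq sq').
Qed.

(* A cycle through a new pair [spoke w] continues from [v]; as long as it uses
   old pairs it follows the arrows of [V], so that it can never come back to the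
   source of a free spoke. *)
Lemma acyclic_free_spokes V : discrete_vector_field Delta V ->
  acyclic Delta V -> acyclic Delta (V :|: free_spokes V)%SET.
Proof.
move=> [prV unV] acV [p [m [sigma [tau [[H1 H2 H3] m0 mE]]]]].
have [/forallP allV|] := boolP [forall i : 'I_m, (sigma i, tau i) \in V].
  apply: acV; exists p, m, sigma, tau; split => //; split => // i im.
  by have [_ ? ?] := H3 i im; split => //; exact: (allV (Ordinal im)).
rewrite negb_forall => /existsP[[i0 im] /= i0V].
pose P j := exists2 x, sigma j = [set x]%SET & connect (arrow V) v x.
have [+ sp sn] := H3 i0 im; rewrite inE (negbTE i0V) /=.
move=> /free_spokesP[w [sE tE] [_ _ wv]].
have simp0 i : (i <= m)%N -> sigma i != finset.set0.
  by move=> /H1[sD _]; exact: simplex_nonempty sD.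
have P1 : P i0.+1.
  exists v => //; apply: (@proper_pair w); rewrite ?simp0 //.
    by rewrite finset.setUC -tE.
  by rewrite -sE.
have PS j : (j < m)%N -> P j -> P j.+1.
  move=> jm [x xE vx]; have [+ jp jn] := H3 j jm; rewrite inE => /orP[jV|].
    have [_ _ /= st td] := prV _ jV.
    have xt : x \in tau j by apply: (fintype.subsetP st); rewrite xE finset.set11.
    have [|y yx tyE] := sdim1P xt; first by rewrite td xE /sdim cards1.
    exists y; first by apply: (@proper_pair x); rewrite -?tyE ?simp0 // -xE.
    apply: connect_trans vx _; apply: connect1.
    by rewrite /arrow /= yx -tyE -xE.
  move=> /free_spokesP[w' [s'E _] [_ _ /negP w'v]]; case: w'v.
  by move: xE; rewrite s'E => /finset.set1_inj ->.
have Pup j l : (j + l <= m)%N -> P j -> P (j + l)%N.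
  elim: l => [|l IH]; first by rewrite addn0.
  rewrite addnS => jlm Pj; apply: PS => //; apply: IH => //; exact: ltnW.
(* [P] persists up to [m], passes to index 0 because the cycle closes, and arrives at [i0], whose
   vertex [w] is not reachable from [v]. *)
have Pm : P m by have := Pup i0.+1 (m - i0.+1)%N; rewrite subnKC //; apply.
have P0 : P 0%N by case: Pm => x xE vx; exists x; rewrite -?mE.
have [x xE vx] : P i0 by apply: (Pup 0%N) => //; exact: ltnW.
by move: xE wv; rewrite sE => /finset.set1_inj ->; rewrite vx.
Qed.

(* Every neighbor of [v] whose spoke is not free is charged to a source of [V]:
   to itself, to its edge, or, if it is the sink reached from [v], to [v]. *)
Lemma neighbors_le_card V : discrete_vector_field Delta V ->
  free_spokes V = finset.set0 -> (#|neighbors| <= #|V|)%N.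
Proof.
move=> [prV unV] G0; pose src : {set {set T}} := [set q.1 | q in V]%SET.
have srcP q : q \in V -> q.1 \in src by move=> qV; apply/imsetP; exists q.
apply: leq_trans (leq_imset_card (fun q => q.1) V : (#|src| <= _)%N).
pose charge w := if [set w]%SET \in src then [set w]%SET
  else if [set v; w]%SET \in src then [set v; w]%SET else [set v]%SET.
(* The spoke is not free, so it suffices to exclude clashes. The vertex [w] has too small a
   dimension to be a target; if its edge is a target, the source must be [v], which gives an arrow
   from [v] to [w]. *)
have reach w : w \in neighbors -> [set w]%SET \notin src ->
    [set v; w]%SET \notin src -> connect (arrow V) v w.
  move=> wn ws vws; have wv : w != v by move: wn; rewrite inE => /andP[].
  apply: contraT => nvw.
  have : spoke w \notin free_spokes V by rewrite G0 inE.
  case/free_spokesP; exists w => //; split => //.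
  apply/forall_inP => q qV; apply/orP; right.
  have [q1D q2D q12 qd] := prV q qV.
  have q1s : q.1 \in src by exact: srcP.
  rewrite !inE !negb_or; apply/andP; split; apply/andP; split.
  - by apply: contraNneq ws => /= ->.
  - by apply/eqP => /= qE; move: qd; rewrite -qE /sdim cards1.
  - by apply: contraNneq vws => /= ->.
  apply/eqP => /= qE; move: qd; rewrite -qE /sdim cards2 eq_sym wv /= => -[/esym qd].
  have [x xE] := sdim0P (simplex_nonempty q1D) qd.
  move: q12; rewrite xE -qE finset.sub1set !inE => /orP[]/eqP xvw; last first.
    by move: ws; rewrite -xvw -xE q1s.
  move/negP: nvw; apply; apply: connect1; rewrite /arrow /= wv /=.
  by rewrite qE -xvw -xE -surjective_pairing.
have arrow_src x y : arrow V x y -> [set x]%SET \in src.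
  by move=> /andP[_ /srcP].
have charge_src w : w \in neighbors -> charge w \in src.
  move=> wn; rewrite /charge; case: ifPn => // ws; case: ifPn => // vws.
  (* As [w] differs from [v], the path has a first arrow, and [v] is a source. *)
  have /connectP[[|y p] /=] := reach w wn ws vws.
    by move=> _ wE; move: wn; rewrite inE wE eqxx.
  by move=> /andP[/arrow_src].
have charge_inj : {in neighbors &, injective charge}.
  move=> w w' wn wn'; have wv : w != v by move: wn; rewrite inE => /andP[].
  have wv' : w' != v by move: wn'; rewrite inE => /andP[].
  rewrite /charge; case: ifPn => [_|ws]; [|case: ifPn => [_|vws]];
    (case: ifPn => [_|ws']; [|case: ifPn => [_|vws']]).
  - exact: finset.set1_inj.
  - by move=> /(set1_neq_pair wv').
  - by move=> /finset.set1_inj/eqP; rewrite (negbTE wv).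
  - by move=> /esym/(set1_neq_pair wv).
  - exact: pair_set_inj.
  - by move=> /esym/(set1_neq_pair wv).
  - by move=> /finset.set1_inj/esym/eqP; rewrite (negbTE wv').
  - by move=> /(set1_neq_pair wv').
  (* Two neighbors charged to [v] are both sinks reached from [v]; arrows are functional since a
     vertex lies in at most one pair. *)
  move=> _; apply: (@connect_sink_unique _ (arrow V) _ v).
  - move=> x y y' /andP[yx xyV] /andP[_ xyV'].
    have [q1D _ _ _] := prV _ xyV.
    have := unV _ _ _ q1D xyV xyV' (or_introl erefl) (or_introl erefl).
    by move=> [/(pair_set_inj yx)].
  - exact: reach.
  - exact: reach.
  - by move=> y; apply: contra ws; exact: arrow_src.
  - by move=> y; apply: contra ws'; exact: arrow_src.
rewrite -(card_in_imset charge_inj); apply/subset_leq_card/fintype.subsetP => s.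
by move=> /imsetP[w wn ->]; exact: charge_src.
Qed.

End Spokes.

(** * Connectivity of the Morse complex *)

Theorem theorem2p7 (R : realType) (T : finType) (Delta : simplicial_complex T)
    (d : nat) (v : T) (hv : [set v]%SET \in simplices Delta)
    (hd : degree (skeleton 1 Delta) v = d) :
  n_connected R (realization R (morse_complex Delta)) (d%:Z - 2).
Proof.
have dN : (d <= #|neighbors Delta v|)%N by rewrite -hd degree_le_neighbors.
pose G := free_spokes Delta v.
have joinG V : discrete_vector_field Delta V -> acyclic Delta V ->
    V :|: G V != finset.set0 -> (V :|: G V)%SET \in simplices (morse_complex Delta).
  move=> dvfV acV V0; rewrite inE V0 /=; apply/asboolP; split.
    exact: dvf_free_spokes.
  exact: acyclic_free_spokes.
(* For [d = 0] there may be no spoke, but then the claim is vacuous. *)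
have G0 : (0 < d)%N -> G finset.set0 \in simplices (morse_complex Delta).
  move=> d0; rewrite -[G _]finset.set0U; apply: joinG.
  - by split=> [q|s q q' _]; rewrite inE.
  - move=> [p [m [sigma [tau [[_ _ H] m0 _]]]]].
    by have [] := H 0%N m0; rewrite inE.
  rewrite finset.set0U /G free_spokes0 -card_gt0.
  have /card_gt0P[w wn] := leq_trans d0 dN.
  by apply/card_gt0P; exists (spoke v w); apply/imsetP; exists w.
split=> [d1|k kd x0].
  have {}d1 : (0 < d)%N by lia.
  have /finset.set0Pn[a aG] := simplex_nonempty (G0 d1).
  by have [x _] := vertex_point R (G0 d1) aG; exists x.
(* A field with at most [k + 1] pairs then has fewer pairs than [v] has neighbors, so some spoke is
   free. *)
have {}kd : (k.+1 < d)%N by lia.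
apply: (@vanishing_criterion _ _ _ G k) => //.
- by move=> V W _; exact: free_spokes_anti.
- move=> V; rewrite inE => /andP[V0 /asboolP[dvfV acV]]; apply: joinG => //.
  by apply: contraNneq V0 => V0; rewrite -finset.subset0 -V0 finset.subsetUl.
- by apply: G0; exact: leq_ltn_trans kd.
move=> V; rewrite inE => /andP[_ /asboolP[dvfV _]] Vk.
apply/eqP => GV0; have := neighbors_le_card dvfV GV0.
by rewrite leqNgt (leq_ltn_trans Vk) // (leq_trans kd).
Qed.
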